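(* For every $\delta\in[1,2]$ and every integer $\ell\ge 3$, $$\alpha_\star(\delta,\ell)\ \le\ 1+\sqrt{1-\frac{(2-\delta)^2}{2-\dfrac{1}{3\cdot 2^{\ell-3}-\ell+2}}}.$$
   Context: $\log$ denotes the base 2 logarithm, and $G(n,1/2)$ is the Erdős–Rényi random graph on $n$ labelled vertices in which every pair is an edge independently with probability $1/2$. Adaptive query algorithms. An algorithm knows $n$ and interacts with a hidden $G\sim G(n,1/2)$ only by querying pairs of vertices; a query reveals whether the pair is an edge of $G$. Computation time is unlimited; only queries are counted. For $\ell\in\mathbb N$, an $\ell$-adaptive algorithm makes its queries in $\ell$ rounds: all queries of a round are made simultaneously, and their choice may depend only on the answers received in previous rounds. ''With high probability'' means with probability tending to $1$ as $n\to\infty$. $\alpha_\star(\delta,\ell)$ is the supremum of all $\alpha$ for which there is an $\ell$-adaptive algorithm that makes at most $n^\delta$ queries in total and outputs, with high probability, a clique of $G\sim G(n,1/2)$ of size $\alpha\log n$ (up to rounding to an integer). *)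

(* Defs.v *)
From HB Require Import structures.
From mathcomp Require Import all_boot all_order all_algebra.
From mathcomp Require Import all_classical all_reals all_analysis.
Import Order.TTheory GRing.Theory Num.Theory.
Import numFieldNormedType.Exports.

Set Implicit Arguments.
Unset Strict Implicit.
Unset Printing Implicit Defensive.

Local Open Scope classical_set_scope.
Local Open Scope ring_scope.

Definition vpair (n : nat) := {e : {set 'I_n} | #|e| == 2}.

(* A simple graph on 'I_n is given by its edge set. *)
Definition sgraph (n : nat) := {set vpair n}.

Definition clique (n : nat) (G : sgraph n) (S : {set 'I_n}) : bool :=
  [forall e : vpair n, (val e \subset S) ==> (e \in G)].

Section ErdosRenyi.
Variables (R : realType) (n : nat) (p : R).

Definition er_mass (G : sgraph n) : R :=
  \prod_(e : vpair n) (if e \in G then p else 1 - p).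

Definition er_prob (E : pred (sgraph n)) : R :=
  \sum_(G : sgraph n | E G) er_mass G.

End ErdosRenyi.

(* A deterministic query strategy on n vertices. Its argument is the list of
   the answers of the rounds already played: the answer of a round is the set
   of those queried pairs that are edges. The query sets themselves need not
   be recorded, as the strategy recomputes them from the earlier answers; the
   index of the current round is the length of the list. *)
Record strategy (n : nat) := Strategy {
  ask : seq {set vpair n} -> {set vpair n};
  guess : seq {set vpair n} -> {set 'I_n}
}.

Section Run.
Variables (n : nat) (A : strategy n) (G : sgraph n).

Fixpoint answers (l : nat) : seq {set vpair n} :=
  if l is k.+1 then rcons (answers k) (ask A (answers k) :&: G) else [::].

Definition num_queries (l : nat) : nat := (\sum_(i < l) #|ask A (answers i)|)%N.

Definition output (l : nat) : {set 'I_n} := guess A (answers l).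

End Run.

Definition log2 (R : realType) (x : R) : R := ln x / ln 2.

(* The target size is rounded down, with value 0 when a < 0. *)
Definition finds_clique (R : realType) (l : nat) (a : R) (n : nat)
    (A : strategy n) (G : sgraph n) : bool :=
  clique G (output A G l) &&
  (#|output A G l| == Num.truncn (a * log2 n%:R)).

Definition achievable (R : realType) (delta : R) (l : nat) (a : R) : Prop :=
  exists A : forall n, strategy n,
    (forall n (G : sgraph n), (num_queries (A n) G l)%:R <= n%:R `^ delta) /\
    er_prob 2^-1 (finds_clique l a (A n)) @[n --> \oo] --> (1 : R).

Definition alpha_star (R : realType) (delta : R) (l : nat) : \bar R :=
  ereal_sup [set a%:E | a in [set a : R | achievable delta l a]].

(* Main.v *)
Require Import Defs.
From HB Require Import structures.
From mathcomp Require Import all_boot all_order all_algebra.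
From mathcomp Require Import zify ring lra.

(** The proof is a first moment computation over short certificates of the
    cliques that a strategy can find. Take n = 2 ^ j with j large.

    A pair of the output that was never asked is, given all answers, an edge
    with probability 1/2 ([card_unasked_clique]); hence a strategy that
    succeeds with probability tending to 1 outputs, with probability at least
    1/4 or so, a clique S of k ~ a j vertices all of whose pairs were asked.
    Give each pair of S the round in which it was first asked.

    Choose a matching M of m pairs inside S. A pair of M can be named by its
    round and its rank among the at most n ^ delta pairs asked in that round,
    so S is described by a code in a set of about
    n ^ (delta m) * n ^ (k - 2 m) elements, instead of n ^ k
    ([card_code]). Read forwards in time, the code announces the vertices of S:
    those outside M at the start, and the two ends of a pair of M when the
    round of that pair begins. A pair of S is fresh if it is first asked when
    both its ends have already been announced, and stale otherwise. Which pairs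
    are fresh is decided before their answers are known, so for a fixed code
    the graphs with b fresh pairs, all of them edges, have probability at most
    2 ^ - b ([card_fresh_le]). It remains to find, in each S, a matching with
    few stale pairs, and to sum over the codes ([card_asked_clique]).

    With Q = 3 * 2 ^ (l - 2) - 2 l + 4, S has, as soon as 2 m <= k, a
    matching of size m with at most (1 - 1 / Q) m ^ 2 stale pairs ([few_stale_pairs]). It is a
    matching of minimal weight, where a pair of round t weighs W_t and the
    increments of W roughly double from one round to the next. No exchange of
    some pairs of M for others of smaller total weight is possible, and this
    has three consequences. A stale pair has both ends in M. Two pairs of M,
    the later of round j, are joined by at most 2 stale pairs, for otherwise
    they could be replaced by two disjoint pairs of rounds below j. Finally,
    among the pairs of M of round j, a path that alternates between pairs of M
    and pairs of rounds below j contains at most q_j pairs of M, for otherwise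
    it could be closed up into a cycle by an arbitrary pair and the pairs of M
    on it be exchanged for the others. By a Turán-type theorem
    ([alternating_turan]) the last property leaves at most
    (1 - 1 / q_j) m_j ^ 2 stale pairs between the m_j pairs of M of round j.
    The total is at most m ^ 2 minus the sum of the m_j ^ 2 / q_j, which by
    the Cauchy-Schwarz inequality is at most (1 - 1 / Q) m ^ 2, as Q is the sum
    of the q_j.

    With m ~ mu j and c = 1 - 1 / Q the expected number of cliques found is
    at most 2 to the power (a - a ^ 2 / 2 - (2 - delta) mu + c mu ^ 2) j ^ 2 + O(j). The
    coefficient of j ^ 2 is smallest for mu = (2 - delta) / (2 c), where it is
    negative exactly when (a - 1) ^ 2 > 1 - (2 - delta) ^ 2 / (2 c). Since
    2 c = 2 - 1 / (Q / 2), this is the stated bound. *)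

Set Implicit Arguments.
Unset Strict Implicit.
Unset Printing Implicit Defensive.

(** * A Turán-type bound for alternating paths *)

Definition edge (V : finType) (p : V * V) : {set V} := [set p.1; p.2].

Section Turan.
Variables (V : finType) (H : rel V).
Hypothesis Hsym : symmetric H.

(** Incidences are ordered: over a set of disjoint pairs, the double sum of
    [crossing] counts every edge of [H] twice. *)
Definition crossing (e f : {set V}) : nat := \sum_(x in e) \sum_(y in f) H x y.

(** Each entry of the list is a matching edge with a direction of traversal;
    the [H]-edges run from the end of an entry to the start of the next. *)
Definition alternating (P : seq (V * V)) := sorted (fun p p' => H p.2 p'.1) P.

Lemma crossingC e f : crossing e f = crossing f e.
Proof.
rewrite /crossing exchange_big; apply: eq_bigr => x _.
by apply: eq_bigr => y _; rewrite Hsym.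
Qed.

Lemma sum_sorted_le (h : V -> nat) p0 (P : seq (V * V)) :
    path (fun p p' => h p.2 + h p'.1 <= 2) p0 P ->
  \sum_(p <- p0 :: P) (h p.1 + h p.2)
    <= h p0.1 + 2 * size P + h (last p0 P).2.
Proof.
elim: P p0 => [|p P IH] p0 /=.
  by move=> _; rewrite big_seq1; lia.
case/andP=> hp /IH le2.
by rewrite big_cons; lia.
Qed.

Lemma path_split (T : Type) (r : rel T) x (s : seq T) :
    (forall A y z B, x :: s = A ++ y :: z :: B -> r y z) -> path r x s.
Proof.
elim: s x => //= y s IH x hs; apply/andP; split; first exact: (hs [::] x y s).
by apply: IH => A z t B eqs; apply: (hs (x :: A) z t B); rewrite eqs.
Qed.

Lemma sum_edge (g : V -> nat) x y : x != y ->
  \sum_(z in [set x; y]) g z = g x + g y.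
Proof. by move=> xy; rewrite big_setU1 ?inE //= big_set1. Qed.

Lemma alternating_insert p q r A B : alternating (A ++ p :: r :: B) ->
  H p.2 q.1 -> H q.2 r.1 -> alternating (A ++ p :: q :: r :: B).
Proof.
rewrite /alternating; case: A => [|a A] /=.
  by case/andP=> _ -> -> ->.
rewrite !cat_path /= => /and4P[-> -> _ ->] -> ->.
by [].
Qed.

(** If [e = {u, v}] were joined to an end of a longest path, the path could be
    prolonged by [e]. For two consecutive entries, [e] can be inserted between
    them as soon as [u] is joined to one end of the gap and [v] to the other,
    so each of the [size P] gaps receives at most two edges from [e]. *)
Lemma longest_path_crossing (C : {set {set V}}) p0 P (e : {set V}) :
    let P0 := p0 :: P in
    {subset map (@edge V) P0 <= C} -> uniq (map (@edge V) P0) ->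
    alternating P0 ->
    (forall P', {subset map (@edge V) P' <= C} -> uniq (map (@edge V) P') ->
      alternating P' -> size P' <= size P0) ->
    (forall f, f \in C -> #|f| = 2) ->
    e \in C -> e \notin map (@edge V) P0 ->
  \sum_(p <- P0) crossing e (edge p) <= 2 * size P.
Proof.
move=> P0 sub uq alt max C2 eC eP.
have /eqP/cards2P[u [v [uv ee]]] := C2 _ eC.
have edge_ne p : p \in P0 -> p.1 != p.2.
  move=> pP; have /C2 := sub _ (map_f _ pP).
  by rewrite /edge cards2; case: (p.1 != p.2).
have noext q P' : edge q = e -> perm_eq P' (q :: P0) -> ~ alternating P'.
  move=> qe pe altP'.
  have pe' := perm_map (@edge V) pe.
  suff : size P' <= size P0 by rewrite (perm_size pe) /= ltnn.
  apply: max altP'.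
    by move=> f; rewrite (perm_mem pe') /= inE qe => /predU1P[->|/sub].
  by rewrite (perm_uniq pe') /= qe eP; exact: uq.
have euv : edge (u, v) = e by rewrite ee.
have evu : edge (v, u) = e by rewrite ee /edge setUC.
pose h z := H u z + H v z.
have -> : \sum_(p <- P0) crossing e (edge p) = \sum_(p <- P0) (h p.1 + h p.2).
  rewrite big_seq [RHS]big_seq; apply: eq_bigr => p /edge_ne pne.
  by rewrite /crossing ee sum_edge // /edge !sum_edge // /h addnACA.
have h0 : h p0.1 = 0.
  rewrite /h; case: (boolP (H u p0.1)) => [hu|_].
    by case: (noext _ ((v, u) :: P0) evu (perm_refl _)); rewrite /alternating /= hu.
  case: (boolP (H v p0.1)) => [hu|//].
  by case: (noext _ ((u, v) :: P0) euv (perm_refl _)); rewrite /alternating /= hu.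
have h1 : h (last p0 P).2 = 0.
  rewrite /h Hsym; case: (boolP (H _ u)) => [hu|_].
    case: (noext _ (rcons P0 (u, v)) euv); first by rewrite perm_rcons.
    by rewrite /alternating /= rcons_path hu andbT.
  rewrite Hsym; case: (boolP (H _ v)) => [hu|//].
  case: (noext _ (rcons P0 (v, u)) evu); first by rewrite perm_rcons.
  by rewrite /alternating /= rcons_path hu andbT.
apply: leq_trans (_ : _ <= h p0.1 + 2 * size P + h (last p0 P).2) _; last first.
  by rewrite h0 h1 addn0.
apply: sum_sorted_le; apply: path_split => A p p' B eqP; rewrite -/P0 in eqP.
have ins q : edge q = e -> ~~ (H p.2 q.1 && H q.2 p'.1).
  move=> qe; apply/negP => /andP[h2 h3].
  apply: (noext q (A ++ p :: q :: p' :: B) qe).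
    rewrite eqP -[A ++ _]cat_rcons -[A ++ p :: p' :: B]cat_rcons.
    by rewrite -[q :: p' :: B]cat1s perm_catCA.
  by apply: alternating_insert => //; rewrite -eqP.
move: (ins _ euv) (ins _ evu); rewrite /= /h !(Hsym p.2).
by case: (H u p.2); case: (H v p.2); case: (H u p'.1); case: (H v p'.1).
Qed.

(** As in the proof of Turán's theorem, remove a substructure and induct. The
    substructure removed is a longest alternating path, with [s <= q] matching
    edges: inside it each pair of matching edges is joined by at most 2 edges,
    and every other matching edge sends at most [2 * s.-1] edges to it, so that
    the part removed accounts for at most the fraction [1 - 1 / s] of the
    square. *)
Lemma alternating_turan q (C : {set {set V}}) :
    (forall f, f \in C -> #|f| = 2) ->
    (forall f, f \in C -> crossing f f = 0) ->
    (forall e f, e \in C -> f \in C -> e != f -> crossing e f <= 2) ->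
    (forall P, {subset map (@edge V) P <= C} -> uniq (map (@edge V) P) ->
      alternating P -> size P <= q) ->
  q * (\sum_(e in C) \sum_(f in C) crossing e f) <= 2 * q.-1 * #|C| ^ 2.
Proof.
elim: {C}_.+1 {-2}C (ltnSn #|C|) => // N IH C; rewrite ltnS => leN C2 Cff Cef Cq.
have [->|[e0 e0C]] := set_0Vmem C; first by rewrite big_set0 muln0.
have [u0 [v0 [_ ee0]]] : exists u v, u != v /\ e0 = [set u; v].
  by have /eqP/cards2P := C2 _ e0C.
pose good P := [&& all (mem C) (map (@edge V) P), uniq (map (@edge V) P)
  & alternating P].
pose has_size s := [exists P : s.-tuple (V * V), good P].
have ex1 : has_size 1.
  by apply/existsP; exists [tuple (u0, v0)]; rewrite /good /= /edge -ee0 e0C.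
have goodP P : good P -> [/\ {subset map (@edge V) P <= C},
    uniq (map (@edge V) P) & alternating P].
  by case/and3P=> /allP.
have bnd s : has_size s -> s <= q.
  by case/existsP=> P /goodP[h1 h2 h3]; rewrite -(size_tuple P) Cq.
have exs : exists s, has_size s by exists 1.
case: (ex_maxnP exs bnd) => s hs smax.
have s1 := smax _ ex1; have sq := bnd _ hs.
case/existsP: hs => P /goodP[sub uq alt].
have max P' : {subset map (@edge V) P' <= C} -> uniq (map (@edge V) P') ->
    alternating P' -> size P' <= s.
  move=> h1 h2 h3; apply: smax; apply/existsP; exists (in_tuple P').
  by rewrite /good /= h2 h3 andbT andbT; apply/allP.
have sP := size_tuple P; move: (tval P) sP sub uq alt => {}P sP sub uq alt.
pose D := [set e in map (@edge V) P].
have DC : D \subset C by apply/subsetP => e; rewrite inE => /sub.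
have cD : #|D| = s by rewrite cardsE (card_uniqP uq) size_map.
have sumD (g : {set V} -> nat) : \sum_(e in D) g e = \sum_(p <- P) g (edge p).
  rewrite -[RHS](big_map (@edge V) predT g) big_uniq //.
  by apply: eq_bigl => e; rewrite inE.
pose R := C :\: D.
have splitC (g : {set V} -> nat) :
    \sum_(e in C) g e = \sum_(e in D) g e + \sum_(e in R) g e.
  by rewrite (big_setID D) /= (setIidPr DC).
have cC : #|C| = s + #|R| by rewrite -(cardsID D) (setIidPr DC) cD.
have memR e : e \in R -> e \in C /\ e \notin map (@edge V) P.
  by rewrite inE => /andP[]; rewrite inE.
have IHR : q * (\sum_(e in R) \sum_(f in R) crossing e f)
    <= 2 * q.-1 * #|R| ^ 2.
  apply: IH; first by lia.
  - by move=> f /memR[/C2].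
  - by move=> f /memR[/Cff].
  - by move=> e f /memR[eC _] /memR[fC _]; exact: Cef.
  by move=> P' sub' uq' alt'; apply: Cq => // e /sub' /memR[].
have DD : \sum_(e in D) \sum_(f in D) crossing e f <= s * (2 * s.-1).
  rewrite -{1}cD -sum_nat_const; apply: leq_sum => e eD.
  rewrite (bigD1 e) //= Cff ?(subsetP DC) // add0n.
  have -> : 2 * s.-1 = \sum_(f in D :\ e) 2.
    by rewrite sum_nat_const -cD (cardsD1 e D) eD mulnC.
  rewrite [leqRHS](eq_bigl (fun f => (f \in D) && (f != e))).
    apply: leq_sum => f /andP[fD fe].
    by rewrite Cef ?(subsetP DC) // eq_sym.
  by move=> f; rewrite !inE andbC.
have RD : \sum_(e in R) \sum_(f in D) crossing e f <= #|R| * (2 * s.-1).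
  rewrite -sum_nat_const; apply: leq_sum => e /memR[eC eP].
  rewrite sumD; case: P sP sub uq alt eP {D DC cD sumD R splitC cC memR IHR DD}
    => [|p0 P] sP sub uq alt eP; first by rewrite -sP in s1.
  rewrite -sP; apply: (@longest_path_crossing C) => //.
  by move=> P'; rewrite /= in sP *; rewrite sP; exact: max.
have DR : \sum_(e in D) \sum_(f in R) crossing e f <= #|R| * (2 * s.-1).
  by rewrite exchange_big /=; under eq_bigr do under eq_bigr do rewrite crossingC.
rewrite splitC (eq_bigr _ (fun e _ => splitC _)).
rewrite [X in _ + X](eq_bigr _ (fun e _ => splitC _)) !big_split /= cC.
move: DD RD DR IHR; set dd := \sum_(e in D) \sum_(f in D) _.
set rd := \sum_(e in R) \sum_(f in D) _; set dr := \sum_(e in D) \sum_(f in R) _.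
set rr := \sum_(e in R) \sum_(f in R) _; set r := #|R|.
move=> h1 h2 h3 h4; case: s s1 sq h1 h2 h3 {max cD cC smax sP} => // s _ sq h1 h2 h3; case: q {IH Cq bnd} sq h4 => // q.
rewrite ltnS /= => sq h4.
have : q.+1 * (dd + dr + (rd + rr))
    <= q.+1 * (s.+1 * (2 * s) + r * (2 * s) + r * (2 * s)) + 2 * q * r ^ 2.
  rewrite (_ : _ + (rd + rr) = dd + dr + rd + rr); last by lia.
  rewrite mulnDr leq_add // leq_mul2l /=; lia.
move/leq_trans; apply; nia.
Qed.
End Turan.

(** * Matchings of minimal weight *)

Section Verts.
Variable V : finType.
Implicit Types (M P R : seq (V * V)) (p : V * V).

Definition verts M : seq V := flatten [seq [:: p.1; p.2] | p <- M].

Lemma mem_edge z p : (z \in edge p) = (z == p.1) || (z == p.2).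
Proof. by rewrite !inE. Qed.

Lemma verts_cons p M : verts (p :: M) = p.1 :: p.2 :: verts M.
Proof. by []. Qed.

Lemma verts_cat M M' : verts (M ++ M') = verts M ++ verts M'.
Proof. by rewrite /verts map_cat flatten_cat. Qed.

Lemma size_verts M : size (verts M) = (size M).*2.
Proof. by elim: M => //= p M ->. Qed.

Lemma vertsP z M : reflect (exists2 p, p \in M & z \in edge p) (z \in verts M).
Proof.
apply: (iffP idP) => [/flatten_mapP[p pM]|[p pM zp]].
  by rewrite !inE => zp; exists p; rewrite // mem_edge.
by apply/flatten_mapP; exists p; rewrite // !inE -mem_edge.
Qed.

Lemma uniq_verts_cons p M : uniq (verts (p :: M)) =
  [&& p.1 != p.2, p.1 \notin verts M, p.2 \notin verts M & uniq (verts M)].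
Proof. by rewrite verts_cons /= inE negb_or -!andbA. Qed.

Lemma edge_meet M p p' z : uniq (verts M) -> p \in M -> p' \in M ->
  z \in edge p -> z \in edge p' -> p = p'.
Proof.
have notinv q r N : r \in N -> q.1 \notin verts N -> q.2 \notin verts N ->
    z \in edge q -> z \in edge r -> False.
  move=> rN q1 q2 zq zr; have zN : z \in verts N by apply/vertsP; exists r.
  by move: zq; rewrite mem_edge => /pred2P[]eqz; move: q1 q2; rewrite -eqz zN.
elim: M => // q M IH; rewrite uniq_verts_cons => /and4P[_ q1 q2 uM].
move=> /predU1P[->|pM] /predU1P[->|p'M] // zp zp'.
- by case: (notinv _ _ _ p'M q1 q2 zp zp').
- by case: (notinv _ _ _ pM q1 q2 zp' zp).
exact: IH.
Qed.

Lemma uniq_edges M : uniq (verts M) -> uniq (map (@edge V) M).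
Proof.
elim: M => // p M IH uM; have := uM; rewrite uniq_verts_cons.
case/and4P=> _ p1 _ /IH /= ->; rewrite andbT.
apply/mapP => -[r rM epr]; case/negP: p1; apply/vertsP; exists r => //.
by rewrite -epr mem_edge eqxx.
Qed.

Lemma edge_neq M p : uniq (verts M) -> p \in M -> p.1 != p.2.
Proof.
elim: M => // q M IH; rewrite uniq_verts_cons inE => /and4P[q12 _ _ /IH h].
by case/predU1P=> [->|/h].
Qed.

Lemma uniq_verts_filter a M : uniq (verts M) -> uniq (verts (filter a M)).
Proof.
elim: M => // p M IH; rewrite uniq_verts_cons => /and4P[p12 p1 p2 /IH uM] /=.
case: (a p) => //; rewrite uniq_verts_cons p12 uM andbT /=.
have sub z : z \in verts (filter a M) -> z \in verts M.
  by case/vertsP=> r; rewrite mem_filter => /andP[_ rM] zr; apply/vertsP; exists r.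
by rewrite (contra (sub _) p1) (contra (sub _) p2).
Qed.

(** The new edges when the matching edges of an alternating path starting at
    [x] are exchanged for the edges that join the end of each to the start of
    the next, the last one being joined back to [x]. *)
Fixpoint shift (x : V) p P : seq (V * V) :=
  if P is r :: P' then (p.2, r.1) :: shift x r P' else [:: (p.2, x)].

Lemma size_shift x p P : size (shift x p P) = (size P).+1.
Proof. by elim: P p => //= r P IH p; rewrite IH. Qed.

Lemma perm_shift x p P : perm_eq (verts (shift x p P)) (x :: p.2 :: verts P).
Proof.
elim: P p => [|r P IH] p.
  by apply/permP => a; rewrite /= ; lia.
have /permP h := IH r.
by apply/permP => a; rewrite [shift _ _ _]/= !verts_cons /= h /=; lia.
Qed.

End Verts.

Section MinMatching.
Variables (V : finType) (S : {set V}) (rho : {set V} -> nat) (W : nat -> nat).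
Variable m : nat.
Implicit Types (M P R : seq (V * V)) (p : V * V).

Definition weight M := \sum_(p <- M) W (rho (edge p)).

Definition matching M :=
  [&& size M == m, uniq (verts M) & all (mem S) (verts M)].

Definition min_matching M :=
  matching M /\ forall M', matching M' -> weight M <= weight M'.

Lemma matching_of_seq (s : seq V) k : uniq s -> {subset s <= S} ->
  k.*2 <= size s ->
  exists2 M : seq (V * V), size M = k & uniq (verts M) /\ {subset verts M <= s}.
Proof.
elim: k s => [|k IH] s us ss; first by exists [::].
case: s us ss => [|x [|y s]] //=; rewrite inE negb_or -!andbA.
case/and4P=> xy xs ys us ss; rewrite !ltnS => ks.
have ss' : {subset s <= S} by move=> z zs; rewrite ss // !inE zs !orbT.
have [M sM [uM Ms]] := IH s us ss' ks; exists ((x, y) :: M); first by rewrite /= sM.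
split; last by move=> z; rewrite verts_cons !inE => /or3P[->|->|/Ms->]; rewrite ?orbT.
by rewrite uniq_verts_cons xy uM (contra (Ms _) xs) (contra (Ms _) ys).
Qed.

Lemma ex_min_matching : m.*2 <= #|S| -> exists M, min_matching M.
Proof.
move=> mS.
have [M0 sM0 [uM0 M0S]] : exists2 M : seq (V * V), size M = m &
    uniq (verts M) /\ {subset verts M <= enum S}.
  apply: matching_of_seq; first exact: enum_uniq.
    by move=> z; rewrite mem_enum.
  by rewrite -cardE.
have mM0 : matching M0.
  rewrite /matching sM0 eqxx uM0; apply/allP => z /M0S.
  by rewrite mem_enum.
pose Pw w := [exists M : m.-tuple (V * V), matching M && (weight M == w)].
have inPw M : matching M -> Pw (weight M).
  move=> mM; have /and3P[sM _ _] := mM.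
  by apply/existsP; exists (Tuple sM); rewrite /= mM eqxx.
have exw : exists w, Pw w by exists (weight M0); exact: inPw.
case: (ex_minnP exw) => w /existsP[M /andP[mM /eqP <-]] hmin.
by exists M; split=> // M' /inPw /hmin.
Qed.

Variable M : seq (V * V).
Hypothesis minM : min_matching M.

Let mM : matching M := proj1 minM.
Let uM : uniq (verts M). Proof. by case/and3P: mM. Qed.

(** Replacing the edges of [P] by those of [P'] gives a matching again, which
    cannot be lighter. The edges are compared as sets, so [P] may list edges of
    [M] in any order and in either direction. *)
Lemma exchange P P' :
    {subset map (@edge V) P <= map (@edge V) M} -> uniq (map (@edge V) P) ->
    size P' = size P -> uniq (verts P') -> {subset verts P' <= S} ->
    (forall z, z \in verts P' -> z \in verts M -> z \in verts P) ->
  weight P <= weight P'.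
Proof.
move=> sub uP szP' uP' P'S P'M.
pose R := [seq p <- M | edge p \notin map (@edge V) P].
have perm : perm_eq (map (@edge V) M) (map (@edge V) P ++ map (@edge V) R).
  apply: uniq_perm; first exact: uniq_edges.
    rewrite cat_uniq uP uniq_edges ?uniq_verts_filter // andbT /=.
    apply/hasPn => e /mapP[r]; rewrite mem_filter => /andP[rP _] ->.
    exact: rP.
  move=> e; rewrite mem_cat; apply/idP/idP => [eM|/orP[/sub//|]].
    case: (boolP (e \in map _ P)) => //= eP.
    case/mapP: eM => r rM er; apply/mapP; exists r => //.
    by rewrite mem_filter -er eP rM.
  case/mapP=> r; rewrite mem_filter => /andP[_ rM] ->.
  exact: map_f.
have wE : weight M = weight P + weight R.
  rewrite /weight -(big_map (@edge V) predT (fun e => W (rho e))).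
  by rewrite (perm_big _ perm) big_cat /= !big_map.
have szM : size M = size P + size R.
  by have := perm_size perm; rewrite size_cat !size_map.
have RM z : z \in verts R -> z \in verts M.
  by case/vertsP=> r; rewrite mem_filter => /andP[_ rM] zr; apply/vertsP; exists r.
have : weight M <= weight (P' ++ R).
  apply: (proj2 minM); case/and3P: mM => /eqP sM _ /allP MS.
  rewrite /matching size_cat szP' -szM sM eqxx /=.
  rewrite verts_cat cat_uniq uP' uniq_verts_filter // andbT /=.
  apply/andP; split; last first.
    by apply/allP => z; rewrite mem_cat => /orP[/P'S//|/RM /MS].
  apply/hasPn => z zR; apply/negP => /= zP'.
  have /vertsP[p pP zp] := P'M z zP' (RM z zR).
  have /mapP[p' p'M ep] := sub _ (map_f _ pP).
  case/vertsP: zR => r; rewrite mem_filter => /andP[rP rM] zr.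
  have prr : p' = r by apply: (edge_meet uM p'M rM _ zr); rewrite -ep.
  by case/negP: rP; rewrite -prr -ep map_f.
by rewrite wE [weight (P' ++ R)]/weight big_cat leq_add2r.
Qed.

Definition medges : {set {set V}} := [set e in map (@edge V) M].

Lemma card_medges : #|medges| = m.
Proof.
rewrite cardsE (card_uniqP _) ?uniq_edges // size_map.
by case/and3P: mM => /eqP.
Qed.

Lemma card_medge e : e \in medges -> #|e| = 2.
Proof.
by rewrite inE => /mapP[p pM ->]; rewrite cards2 (edge_neq uM pM).
Qed.

Lemma medge_sub e : e \in medges -> e \subset S.
Proof.
rewrite inE => /mapP[p pM ->]; apply/subsetP => z zp.
by case/and3P: mM => _ _ /allP; apply; apply/vertsP; exists p.
Qed.

Lemma trivIset_medges : trivIset medges.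
Proof.
apply/trivIsetP => e f; rewrite !inE => /mapP[p pM ->] /mapP[r rM ->].
apply: contraNT => /pred0Pn[z /andP[/= zp zr]].
by rewrite (edge_meet uM pM rM zp zr).
Qed.

Lemma mem_cover_medges z : (z \in cover medges) = (z \in verts M).
Proof.
apply/bigcupP/vertsP => [[e]|[p pM zp]].
  by rewrite inE => /mapP[p pM ->] zp; exists p.
by exists (edge p) => //; rewrite inE map_f.
Qed.

Lemma weight2 p p' : weight [:: p; p'] = W (rho (edge p)) + W (rho (edge p')).
Proof. by rewrite /weight big_cons big_seq1. Qed.

Lemma mem_verts_medges P z : {subset map (@edge V) P <= medges} ->
  z \in verts P -> z \in S.
Proof.
move=> sub /vertsP[p pP zp]; apply: (subsetP (medge_sub _)) zp.
by apply: sub; apply: map_f.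
Qed.

Lemma uniq_verts_medges P : {subset map (@edge V) P <= medges} ->
  uniq (map (@edge V) P) -> uniq (verts P).
Proof.
elim: P => // p P IH sub; rewrite map_cons cons_uniq => /andP[pP uP].
have pM : edge p \in medges by apply: sub; rewrite inE eqxx.
have subP : {subset map (@edge V) P <= medges}.
  by move=> e eP; apply: sub; rewrite inE eP orbT.
have nin z : z \in edge p -> z \notin verts P.
  move=> zp; apply: contra pP => /vertsP[r rP zr].
  have rM : edge r \in medges by apply: subP; apply: map_f.
  have /trivIsetP/(_ _ _ pM rM) tI := trivIset_medges.
  case: (eqVneq (edge p) (edge r)) => [->|/tI]; first exact: map_f.
  by rewrite -setI_eq0 => /eqP/setP/(_ z); rewrite !inE -!mem_edge zp zr.
rewrite uniq_verts_cons IH // !nin ?mem_edge ?eqxx ?orbT //=.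
by have := card_medge pM; rewrite cards2; case: eqP.
Qed.

Lemma weight_shift_ge p P : {subset map (@edge V) (p :: P) <= medges} ->
  uniq (map (@edge V) (p :: P)) -> weight (p :: P) <= weight (shift p.1 p P).
Proof.
move=> sub uP; have perm := perm_shift p.1 p P.
apply: exchange => //.
- by move=> e /sub; rewrite inE.
- by rewrite size_shift.
- by rewrite (perm_uniq perm); exact: (uniq_verts_medges sub).
- by move=> z; rewrite (perm_mem perm); exact: (mem_verts_medges (P := p :: P) sub).
by move=> z; rewrite (perm_mem perm).
Qed.

(** A swap is the exchange along the alternating path of two edges. *)
Lemma weight_swap_ge x y u v : [set x; y] \in medges -> [set u; v] \in medges ->
    [set x; y] != [set u; v] ->
  W (rho [set x; y]) + W (rho [set u; v])
    <= W (rho [set x; u]) + W (rho [set y; v]).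
Proof.
move=> xyM uvM ne.
have := @weight_shift_ge (x, y) [:: (v, u)].
rewrite /= !weight2 /edge /= [[set v; u]]setUC [[set u; x]]setUC.
rewrite [X in _ <= X]addnC; apply; last by rewrite inE ne.
by move=> e; rewrite in_cons mem_seq1 => /pred2P[]->.
Qed.

Lemma weight_replace_ge x y z : [set x; y] \in medges -> z \in S ->
  z \notin cover medges -> W (rho [set x; y]) <= W (rho [set x; z]).
Proof.
rewrite mem_cover_medges => xyM zS zM.
have := @exchange [:: (x, y)] [:: (x, z)].
rewrite /weight !big_seq1 /=; apply => //.
- by move=> e; rewrite mem_seq1 => /eqP->; move: xyM; rewrite inE.
- rewrite inE andbT; apply: contraNneq zM => <-.
  by rewrite -mem_cover_medges; apply/bigcupP; exists [set x; y]; rewrite ?set21.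
- move=> t; rewrite !inE => /pred2P[]-> //.
  by apply: (subsetP (medge_sub xyM)); rewrite set21.
move=> t; rewrite !inE => /pred2P[]->; rewrite ?eqxx //.
by rewrite (negPf zM).
Qed.

End MinMatching.

(** * Counting stale pairs *)

(** From [2 * m ^ 2 <= q * d] and [2 * M ^ 2 <= Q * D] the mixed term
    [q * D + Q * d] is at least [4 * m * M], by the inequality between the
    arithmetic and the geometric mean. *)
Lemma cauchy_step q d m Q D M : 2 * m ^ 2 <= q * d -> 2 * M ^ 2 <= Q * D ->
  2 * (m + M) ^ 2 <= (q + Q) * (d + D).
Proof.
move=> h1 h2.
have h3 : (4 * (m * M)) ^ 2 <= (q * D + Q * d) ^ 2.
  have := leq_mul h1 h2 => h3.
  apply: leq_trans (_ : 4 * (q * d * (Q * D)) <= _).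
    by rewrite (_ : _ ^ 2 = 4 * (2 * m ^ 2 * (2 * M ^ 2))) ?leq_mul2l //; lia.
  apply: leq_trans (nat_AGM2 (q * D) (Q * d)).
  by apply: eq_leq; lia.
rewrite leq_sqr in h3; lia.
Qed.

(** The Cauchy-Schwarz inequality in Engel's form, the [d j] being upper bounds
    for [2 * m j ^ 2 / q j]. *)
Lemma sum_cauchy n (q d m : nat -> nat) :
    (forall j, j < n -> 2 * m j ^ 2 <= q j * d j) ->
  2 * (\sum_(j < n) m j) ^ 2 <= (\sum_(j < n) q j) * (\sum_(j < n) d j).
Proof.
elim: n => [|n IH] h; first by rewrite !big_ord0.
rewrite !big_ord_recr /= ![_ (\sum_(i < n) _) _]addnC.
by apply: cauchy_step; rewrite ?h // IH // => j jn; rewrite h // ltnW.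
Qed.

Section Stale.
Variables (V : finType) (S : {set V}) (rho : {set V} -> nat).
Variables (W q : nat -> nat) (l m : nat).
Hypothesis rho_lt : forall x y, x \in S -> y \in S -> x != y -> rho [set x; y] < l.
Hypothesis W_mono : forall i j, i < j -> W i < W j.
(* W_convex makes swaps profitable, W_cycle the closing of a path with more
   than q j matching edges of round j, even by an edge of the last round. *)
Hypothesis W_convex : forall i j, 0 < j < l -> 2 * W j.-1 < W i + W j.
Hypothesis q_gt0 : forall j, j < l -> 0 < q j.
Hypothesis W_cycle : forall j, 0 < j < l ->
  q j * W j.-1 + W l.-1 < (q j).+1 * W j.

Variable M : seq (V * V).
Hypothesis minM : min_matching S rho W m M.

Notation E := (medges M).

Definition older j x y := (x != y) && (rho [set x; y] < j).

Lemma olderC j : symmetric (older j).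
Proof. by move=> x y; rewrite /older eq_sym setUC. Qed.

Lemma W_le i j : i <= j -> W i <= W j.
Proof. by rewrite leq_eqVlt => /predU1P[->//|/W_mono/ltnW]. Qed.

Lemma medgeP e : e \in E -> exists x y, x != y /\ e = [set x; y].
Proof. by move/(card_medge minM)/eqP/cards2P. Qed.

Lemma medge_rho e : e \in E -> rho e < l.
Proof.
move=> eE; have [x [y [xy ee]]] := medgeP eE.
have /subsetP sub := medge_sub minM eE; rewrite ee rho_lt //.
  by apply: sub; rewrite ee set21.
by apply: sub; rewrite ee set22.
Qed.

(** Otherwise swapping would replace the two edges by two edges of rounds
    earlier than that of [{u, v}], which [W_convex] makes lighter. *)
Lemma no_older_diagonal x y u v : [set x; y] \in E -> [set u; v] \in E ->
    [set x; y] != [set u; v] -> rho [set x; y] <= rho [set u; v] ->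
  ~~ (older (rho [set u; v]) x u && older (rho [set u; v]) y v).
Proof.
set e := [set x; y]; set f := [set u; v] => eE fE ef le.
apply/negP => /andP[/andP[_ h1] /andP[_ h2]].
have h := weight_swap_ge minM eE fE ef.
have f0 : 0 < rho f < l by rewrite medge_rho // andbT; lia.
have := W_convex (rho e) f0.
have h3 : W (rho [set x; u]) <= W (rho f).-1 by apply: W_le; lia.
have h4 : W (rho [set y; v]) <= W (rho f).-1 by apply: W_le; lia.
by rewrite -/e -/f in h; lia.
Qed.

(** Both ends of a pair that joins [e] to [f] are known only in the later of
    the rounds of [e] and [f]. *)
Definition stale_crossing e f := crossing (older (maxn (rho e) (rho f))) e f.

Lemma stale_crossing_le2 e f : e \in E -> f \in E -> e != f ->
  stale_crossing e f <= 2.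
Proof.
wlog le : e f / rho e <= rho f => [hw eE fE ef|eE fE].
  case/orP: (leq_total (rho e) (rho f)) => le; first exact: hw.
  rewrite /stale_crossing maxnC (crossingC (@olderC _)).
  by apply: hw; rewrite // eq_sym.
have [x [y [xy ee]]] := medgeP eE; have [u [v [uv ef]]] := medgeP fE.
rewrite /stale_crossing (maxn_idPr le) /crossing ee ef => ne.
rewrite ee ef in eE fE le.
have := no_older_diagonal eE fE ne le.
have := @no_older_diagonal x y v u eE; rewrite [[set v; u]]setUC => /(_ fE ne le).
rewrite sum_edge // !sum_edge //.
case: (older _ x u); case: (older _ x v);
by case: (older _ y u); case: (older _ y v).
Qed.

Lemma stale_crossing_self e : e \in E -> stale_crossing e e = 0.
Proof.
move=> eE; have [x [y [xy ee]]] := medgeP eE.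
have jx : rho [set x; y] = rho e by rewrite ee.
rewrite /stale_crossing maxnn; move: (rho e) jx => j jx.
rewrite /crossing ee sum_edge // !sum_edge // /older.
by rewrite !eqxx [[set y; x]]setUC jx ltnn !andbF.
Qed.

Definition layer j := [set e in E | rho e == j].

Lemma weight_shift_le j x p P :
    path (fun p p' : V * V => older j p.2 p'.1) p P ->
    (forall r, r \in shift x p P -> rho (edge r) < l) ->
  weight rho W (shift x p P) <= size P * W j.-1 + W l.-1.
Proof.
elim: P p => [|r P IH] p /=.
  move=> _ h; rewrite /weight big_seq1 W_le //.
  by have := h (p.2, x) (mem_head _ _); lia.
case/andP=> /andP[_ h1] /IH{}IH h; rewrite /weight big_cons mulSn -addnA.
apply: leq_add; first by apply: W_le; rewrite /edge /=; lia.
by apply: IH => t tP; apply: h; rewrite inE tP orbT.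
Qed.

(** Closing up a path with [s.+1] matching edges of round [j] replaces weight
    [s.+1 * W j] by at most [s * W j.-1 + W l.-1], which is smaller for
    [q j <= s]. *)
Lemma layer_path j P : j < l -> {subset map (@edge V) P <= layer j} ->
  uniq (map (@edge V) P) -> alternating (older j) P -> size P <= q j.
Proof.
move=> jl sub uP; case: P sub uP => [|p P] sub uP // alt; rewrite leqNgt.
apply/negP => /= qs.
case: (posnP j) => [j0|j0].
  move: (q_gt0 jl) qs alt {sub uP}; rewrite j0; case: P => [|r P] /=; first by lia.
  by rewrite /older ltn0 andbF.
have subE : {subset map (@edge V) (p :: P) <= E}.
  by move=> e /sub; rewrite inE => /andP[].
have perm := perm_shift p.1 p P.
have ush : uniq (verts (shift p.1 p P)).
  by rewrite (perm_uniq perm); exact: (uniq_verts_medges minM subE).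
have shS z : z \in verts (shift p.1 p P) -> z \in S.
  rewrite (perm_mem perm).
  exact: (mem_verts_medges minM (P := p :: P) subE).
have := weight_shift_ge minM subE uP.
have := @weight_shift_le j p.1 p P alt.
have -> : weight rho W (p :: P) = (size P).+1 * W j.
  rewrite /weight -[(size P).+1]/(size (p :: P)) -sum1_size big_distrl /=.
  rewrite big_seq [RHS]big_seq; apply: eq_bigr => r rP.
  by have := sub _ (map_f _ rP); rewrite inE => /andP[_ /eqP->]; rewrite mul1n.
move=> h1 h2; have {}h1 : weight rho W (shift p.1 p P) <= size P * W j.-1 + W l.-1.
  apply: h1 => r rsh; apply: rho_lt; last exact: edge_neq rsh.
    by apply: shS; apply/vertsP; exists r; rewrite ?mem_edge ?eqxx.
  by apply: shS; apply/vertsP; exists r; rewrite ?mem_edge ?eqxx ?orbT.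
have h3 : (size P).+1 * W j <= size P * W j.-1 + W l.-1 by exact: leq_trans h2 h1.
have h4 : W j.-1 <= W j by apply: W_le; lia.
have j0l : 0 < j < l by rewrite j0 jl.
have := W_cycle j0l; move: qs h3 h4.
move: (size P) (q j) (W j) (W j.-1) (W l.-1) => s k a b c; rewrite ltnS => ks h3 h4 h5.
have [t ets] : exists t, s = k + t by exists (s - k); lia.
have h6 : t * b <= t * a by rewrite leq_mul2l h4 orbT.
by rewrite ets in h3; lia.
Qed.

Lemma sum_layers (F : {set V} -> nat) :
  \sum_(e in E) F e = \sum_(j < l) \sum_(e in layer j) F e.
Proof.
rewrite (exchange_big_dep (mem E)) /=; last by move=> j e _; rewrite inE => /andP[].
apply: eq_bigr => e eE; rewrite (big_pred1 (Ordinal (medge_rho eE))) // => j.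
by rewrite /= inE eE /= eq_sym -val_eqE.
Qed.

(** The diagonal blocks are bounded by [alternating_turan], each off-diagonal
    pair of matching edges contributes at most 2, and the resulting bound
    [2 * m ^ 2 - \sum_j d j] is estimated by [sum_cauchy]. *)
Lemma sum_stale_crossing :
  (\sum_(j < l) q j) * (\sum_(e in E) \sum_(f in E) stale_crossing e f)
    + 2 * m ^ 2 <= 2 * (\sum_(j < l) q j) * m ^ 2.
Proof.
pose n j := #|layer j|.
pose B j := \sum_(e in layer j) \sum_(f in layer j) crossing (older j) e f.
have sum_n : \sum_(j < l) n j = m.
  rewrite -(card_medges minM) -sum1_card sum_layers.
  by apply: eq_bigr => j _; rewrite sum1_card.
have layerE j e : e \in layer j -> e \in E /\ rho e = j.
  by rewrite inE => /andP[-> /eqP].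
have hB j : j < l -> q j * B j <= 2 * (q j).-1 * n j ^ 2.
  move=> jl; apply: (alternating_turan (@olderC j)).
  - by move=> f /layerE[/(card_medge minM)].
  - by move=> f /layerE[/stale_crossing_self]; rewrite /stale_crossing maxnn => h <-.
  - move=> e f /layerE[eE ej] /layerE[fE fj] ne.
    by have := stale_crossing_le2 eE fE ne; rewrite /stale_crossing ej fj maxnn.
  by move=> P; exact: layer_path.
have B_le j : j < l -> B j <= 2 * n j ^ 2.
  move=> jl; rewrite -(leq_pmul2l (q_gt0 jl)).
  by apply: leq_trans (hB j jl) _; rewrite mulnCA mulnA leq_mul2r leq_mul2l; lia.
pose d j := 2 * n j ^ 2 - B j.
have hd j : j < l -> 2 * n j ^ 2 <= q j * d j.
  move=> jl; have := hB j jl; have := q_gt0 jl; rewrite /d.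
  case: (q j) => // k _ /=; rewrite mulnBr => h.
  have e1 : k.+1 * (2 * n j ^ 2) = 2 * n j ^ 2 + 2 * k * n j ^ 2 by lia.
  by rewrite e1; lia.
have total : \sum_(e in E) \sum_(f in E) stale_crossing e f + \sum_(j < l) d j
    <= 2 * m ^ 2.
  rewrite sum_layers -big_split /=.
  have -> : 2 * m ^ 2 = \sum_(j < l) 2 * m * n j.
    by rewrite -big_distrr /= sum_n; lia.
  apply: leq_sum => j _.
  have -> : 2 * m * n j = B j + n j * (2 * (m - n j)) + d j.
    have nm : n j <= m by rewrite -sum_n (bigD1 j) //= leq_addr.
    have := B_le _ (ltn_ord j); rewrite /d.
    have [t ->] : exists t, m = n j + t by exists (m - n j); lia.
    rewrite addKn; lia.
  rewrite leq_add2r.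
  have split_e e : e \in layer j -> \sum_(f in E) stale_crossing e f
      <= \sum_(f in layer j) crossing (older j) e f + 2 * (m - n j).
    move=> /layerE[eE ej]; rewrite (big_setID (layer j)) /=.
    have sub : layer j \subset E by apply/subsetP => f /layerE[].
    rewrite (setIidPr sub); apply: leq_add.
      apply: eq_leq; apply: eq_bigr => f /layerE[_ fj].
      by rewrite /stale_crossing ej fj maxnn.
    have -> : 2 * (m - n j) = \sum_(f in E :\: layer j) 2.
      rewrite sum_nat_const cardsD (setIidPr sub) (card_medges minM) mulnC.
      by [].
    apply: leq_sum => f; rewrite inE => /andP[fj fE].
    by apply: stale_crossing_le2 => //; apply: contraNneq fj => <-; rewrite inE eE ej /=.
  by rewrite /n /B -sum_nat_const -big_split /=; apply: leq_sum split_e.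
have := sum_cauchy hd; rewrite sum_n.
move: total; move: (\sum_(e in E) _) (\sum_(j < l) d j) (\sum_(j < l) q j) => X D Q.
move=> h1 h2; apply: leq_trans (_ : Q * (X + D) <= _).
  by rewrite mulnDr leq_add2l.
by rewrite -mulnA mulnCA leq_mul2l h1 orbT.
Qed.

Definition stale (e : {set V}) :=
  [exists f : {set V}, (f \in E) && (~~ [disjoint e & f] && (rho e < rho f))].

Definition stale_pairs := [set e : {set V} | [&& #|e| == 2, e \subset S & stale e]].

(** If [{z, t}] is stale because of a matching edge at [z] and [t] is not
    matched, then exchanging that edge for [{z, t}] is profitable. *)
Lemma stale_cover e : e \in stale_pairs -> e \subset cover E.
Proof.
rewrite inE => /and3P[e2 /subsetP eS].
case/existsP=> f /andP[fE /andP[/pred0Pn[z /andP[/= ze zf]] lt]].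
apply/subsetP => t te; apply: contraLR lt => tE; rewrite -leqNgt.
have ezt : z != t.
  by apply: contraNneq tE => <-; apply/bigcupP; exists f.
have [y ey] : exists y, f = [set z; y].
  have [x [y [_ ef]]] := medgeP fE; move: zf; rewrite ef !inE.
  by case/pred2P=> ->; [exists y | exists x; rewrite setUC].
have ee : [set z; t] = e.
  apply/eqP; rewrite eqEcard (eqP e2) cards2 ezt andbT.
  by apply/subsetP => s; rewrite !inE => /pred2P[]->.
rewrite ey in fE *; have := weight_replace_ge minM fE (eS _ te) tE.
by rewrite ee leqNgt; apply: contraNleq => /W_mono.
Qed.

Lemma card_stale_pairs :
  2 * #|stale_pairs| <= \sum_(e in E) \sum_(f in E) stale_crossing e f.
Proof.
pose g (e : {set V}) (x y : V) : nat := (x != y) && ([set x; y] == e).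
apply: (@leq_trans
  (\sum_(e in stale_pairs) \sum_(x in cover E) \sum_(y in cover E) g e x y)).
  rewrite mulnC -sum_nat_const; apply: leq_sum => e eT.
  have /subsetP eE := stale_cover eT.
  have /cards2P[x [y [xy ee]]] : #|e| == 2 by move: eT; rewrite inE => /and3P[].
  have xE : x \in cover E by apply: eE; rewrite ee set21.
  have yE : y \in cover E by apply: eE; rewrite ee set22.
  have yx : y != x by rewrite eq_sym.
  rewrite (bigD1 x) //= (bigD1 y) //= [X in _ + X](bigD1 y) ?yE //=.
  rewrite [X in _ + (X + _)](bigD1 x) //= /g xy yx ee [[set y; x]]setUC eqxx /=; lia.
rewrite exchange_big /= (big_trivIset _ (trivIset_medges minM)) /=.
apply: leq_sum => e eE.
under eq_bigr do rewrite exchange_big /= (big_trivIset _ (trivIset_medges minM)) /=.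
rewrite exchange_big /=; apply: leq_sum => f fE.
rewrite /stale_crossing /crossing; apply: leq_sum => x xe; apply: leq_sum => y yf.
case: (boolP (older _ x y)) => [_|]; last rewrite leqn0 sum_nat_eq0.
  rewrite (eq_bigr (fun h => if h == [set x; y] then (x != y : nat) else 0)).
    rewrite -big_mkcondr /=.
    rewrite (eq_bigl (fun h => (h == [set x; y]) && (h \in stale_pairs))); last first.
      by move=> h; rewrite andbC.
    rewrite big_mkcondr big_pred1_eq; case: ifP => // _; exact: leq_b1.
  by move=> h _; rewrite /g [h == _]eq_sym; case: (_ == h); rewrite ?andbT ?andbF.
move=> nold; apply/forallP => h; apply/implyP => hT; rewrite eqb0.
apply: contra nold => /andP[xy /eqP exy]; rewrite /older xy exy /=.
move: hT; rewrite inE => /and3P[_ _ /existsP[r /andP[rE /andP[/pred0Pn[z /andP[/= zh zr]] lt]]]].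
have meet s : s \in E -> z \in s -> rho h < rho s.
  move=> sE zs; case: (eqVneq r s) => [<-//|/(trivIsetP (trivIset_medges minM) _ _ rE sE)].
  by move/pred0P/(_ z); rewrite /= zr zs.
rewrite leq_max; move: zh; rewrite -exy !inE exy => /pred2P[]ez.
  by rewrite meet // ez.
by rewrite (meet f) ?orbT // ez.
Qed.

Lemma card_stale_pairs_le :
  (\sum_(j < l) q j) * #|stale_pairs| + m ^ 2 <= (\sum_(j < l) q j) * m ^ 2.
Proof.
have := sum_stale_crossing; have := card_stale_pairs.
move: (\sum_(e in E) _) (\sum_(j < l) _) => X Q h1 h2.
have : Q * (2 * #|stale_pairs|) <= Q * X by rewrite leq_mul2l h1 orbT.
lia.
Qed.

End Stale.

(** * The weights of the rounds *)

Section Weights.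
Variable l : nat.
Hypothesis hl : 2 < l.

(** The inequality [2 * W j.-1 < W 0 + W j] says that each increment of the
    weights exceeds the sum of the earlier ones, so they have to double at
    least. Here the increments are 1, 1, 2, 4, ... times [l * 2 ^ l], up to
    small corrections: from the second on, the increment [W j - W j.-1] exceeds
    the sum of the earlier ones by [l + 1 - j]. That this margin decreases with
    [j] makes paths of the length allowed by [path_bound] the longest ones. *)
Definition round_weight t :=
  if t is s.+1 then 2 ^ s * (l * 2 ^ l) + t else l.-1.

(** For [0 < j], the smallest [q] with [W l.-1 - W j < q * (W j - W j.-1)]. The
    quotient of the two differences is just above [2 ^ (l - 2) - 1] for [j = 1],
    just below [2 ^ (l - j) - 2] for [1 < j < l.-1], and 0 for [j = l.-1]. In
    the first round no pair is older, so that paths have one matching edge. *)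
Definition path_bound j :=
  if j == 0 then 1 else if j == 1 then 2 ^ (l - 2)
  else if j == l.-1 then 1 else 2 ^ (l - j) - 2.

Lemma round_weight_step t : round_weight t < round_weight t.+1.
Proof.
have h : 0 < 2 ^ l by rewrite expn_gt0.
by case: t => [|t]; rewrite /= ?expn0 ?expnS; nia.
Qed.

Lemma round_weight_mono i j : i < j -> round_weight i < round_weight j.
Proof. by move: i j; apply: homo_ltn ltn_trans round_weight_step. Qed.

Lemma round_weight_convex i j : 0 < j < l ->
  2 * round_weight j.-1 < round_weight i + round_weight j.
Proof.
case: j => //= j jl; apply: (@leq_trans (round_weight 0 + round_weight j.+1)).
  by case: j jl => [|j] jl; have := round_weight_step 0; rewrite /= ?expn0 ?expnS; lia.
rewrite leq_add2r; case: i => // i.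
by apply: ltnW; apply: round_weight_mono.
Qed.

Lemma path_bound_gt0 j : j < l -> 0 < path_bound j.
Proof.
rewrite /path_bound => jl; case: eqP => // j0; case: eqP => [_|j1].
  by rewrite expn_gt0.
case: eqP => // jl1; rewrite subn_gt0.
have [d ->] : exists d, l - j = d.+2 by exists (l - j - 2); lia.
by have : 0 < 2 ^ d; rewrite ?expn_gt0 // !expnS; lia.
Qed.

Lemma round_weight_cycle j : 0 < j < l ->
  path_bound j * round_weight j.-1 + round_weight l.-1
    < (path_bound j).+1 * round_weight j.
Proof.
rewrite /path_bound; case: j => // j /= jl.
have [k lk] : exists k, l = k.+3 by exists (l - 3); lia.
have -> : l.-1 = k.+2 by lia.
case: j jl => [|j] jl /=.
  have := ltn_expl k.+1 (isT : 1 < 2).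
  rewrite lk subSS subn1 /= !expnS expn0; move: (2 ^ k) => a; nia.
case: eqP => [[jk]|jk].
  by rewrite jk expnS; nia.
have [d dk] : exists d, k = j.+1 + d by exists (k - j.+1); lia.
have -> : l - j.+2 = d.+2 by lia.
have lin : d.+3 < 2 ^ d.+2.
  by have := ltn_expl d.+1 (isT : 1 < 2); rewrite (expnS 2 d.+1); lia.
have ek : 2 ^ k.+1 = 2 ^ j * 2 ^ d.+2 by rewrite -expnD; congr (_ ^ _); lia.
rewrite ek; move: (2 ^ d.+2) lin => D lin; rewrite expnS.
move: (l * 2 ^ l) (2 ^ j) => A a.
have [b ->] : exists b, D = b + d.+4 by exists (D - d.+4); lia.
have -> : b + d.+4 - 2 = b + d.+2 by lia.
by rewrite dk; lia.
Qed.

Lemma sum_path_bound : \sum_(j < l) path_bound j + l.*2 = 3 * 2 ^ (l - 2) + 4.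
Proof.
have [k lk] : exists k, l = k.+3 by exists (l - 3); lia.
rewrite -(big_mkord xpredT path_bound) {1}lk big_mkord.
rewrite big_ord_recr /= !big_ord_recl /=.
rewrite {1 2}/path_bound /= {2}/path_bound [X in _ + X + _](_ : _ = 1); last first.
  by rewrite /path_bound /= lk; case: eqP => //; rewrite eqxx.
have -> : \sum_(i < k) path_bound (bump 0 (bump 0 i)) = \sum_(i < k) (2 ^ (k - i).+1 - 2).
  apply: eq_bigr => i _; rewrite /path_bound /bump /= lk.
  have := ltn_ord i => ik; rewrite ifF; last by apply/eqP; lia.
  by congr (_ ^ _ - _); lia.
have sumk : \sum_(i < k) (2 ^ (k - i).+1 - 2) + 2 * k + 4 = 2 ^ k.+2.
  elim: k {lk} => [|k IH]; first by rewrite big_ord0.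
  rewrite big_ord_recl /= subn0.
  have h : 0 < 2 ^ k by rewrite expn_gt0.
  under eq_bigr do rewrite /bump /= add1n subSS.
  move: IH; rewrite !expnS; move: (\sum_(i < k) _) (2 ^ k) h; lia.
have -> : l - 2 = k.+1 by lia.
by move: sumk; rewrite !expnS; lia.
Qed.

End Weights.

Lemma few_stale_pairs (V : finType) (S : {set V}) (rho : {set V} -> nat) l m :
    2 < l -> (forall x y, x \in S -> y \in S -> x != y -> rho [set x; y] < l) ->
    m.*2 <= #|S| ->
  exists M : seq (V * V),
    [/\ size M = m, uniq (verts M), {subset verts M <= S} &
      (\sum_(j < l) path_bound l j) * #|stale_pairs S rho M| + m ^ 2
        <= (\sum_(j < l) path_bound l j) * m ^ 2].
Proof.
move=> hl hrho hm; have [M minM] := ex_min_matching rho (round_weight l) hm.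
exists M; have /and3P[/eqP sM uM /allP MS] := proj1 minM.
split=> //; apply: (card_stale_pairs_le hrho (W := round_weight l)) => //.
- exact: round_weight_mono.
- exact: round_weight_convex.
- exact: path_bound_gt0.
- exact: round_weight_cycle.
Qed.

(** * Fresh queries *)

Lemma card_sgraph n : #|{: sgraph n}| = 2 ^ #|{: vpair n}|.
Proof. by rewrite -cardsT -powersetT card_powerset cardsT. Qed.

Section Queries.
Variables (n : nat) (A : strategy n) (l : nat).
Implicit Types (G : sgraph n) (e : vpair n).

Definition asked G t := ask A (answers A G t).

Definition first_asked G t e :=
  (e \in asked G t) && [forall s : 'I_t, e \notin asked G s].

Lemma answers_prefix G1 G2 t s : answers A G1 t = answers A G2 t -> s <= t ->
  answers A G1 s = answers A G2 s.
Proof.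
elim: t => [|t IH]; first by rewrite leqn0 => _ /eqP->.
rewrite leq_eqVlt => eqA /predU1P[->//|]; rewrite ltnS.
by apply: IH; case/rcons_inj: eqA.
Qed.

Lemma asked_ext G1 G2 t : answers A G1 t = answers A G2 t -> asked G1 t = asked G2 t.
Proof. by rewrite /asked => ->. Qed.

Lemma first_asked_ext G1 G2 t e : answers A G1 t = answers A G2 t ->
  first_asked G1 t e = first_asked G2 t e.
Proof.
move=> eqA; rewrite /first_asked (asked_ext eqA); congr andb.
apply: eq_forallb => s; rewrite (asked_ext (answers_prefix eqA _)) //.
exact: ltnW.
Qed.

Lemma first_asked_exists G t e : e \in asked G t ->
  exists2 s, s <= t & first_asked G s e.
Proof.
move=> et; have ex : exists s, e \in asked G s by exists t.
case: (ex_minnP ex) => s es smin; exists s; first exact: smin.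
rewrite /first_asked es; apply/forallP => u; apply/negP => /smin.
by rewrite leqNgt ltn_ord.
Qed.

Section Fresh.
(* The set of vertices announced when round t begins *)
Variable reg : sgraph n -> nat -> {set 'I_n}.
Hypothesis reg_ext : forall G1 G2 t, answers A G1 t = answers A G2 t ->
  reg G1 t = reg G2 t.

Definition fresh G : {set vpair n} :=
  [set e | [exists t : 'I_l, first_asked G t e && (val e \subset reg G t)]].

Lemma fresh_ext G1 G2 t e s : answers A G1 t = answers A G2 t -> t < l ->
  s <= t -> first_asked G1 s e -> e \in fresh G1 -> e \in fresh G2.
Proof.
move=> eqA tl st fs; rewrite !inE => /existsP[u /andP[fu sub]].
have us : u = s :> nat.
  case/andP: fs fu => es /forallP hs /andP[eu /forallP hu].
  case: (ltngtP u s) => // lt.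
    by have := hs (Ordinal lt); rewrite eu.
  by have := hu (Ordinal lt); rewrite es.
have eqs : answers A G1 u = answers A G2 u.
  by apply: answers_prefix eqA _; rewrite us.
apply/existsP; exists u.
by rewrite -(first_asked_ext _ eqs) fu -(reg_ext eqs) sub.
Qed.

(** The strategy can be replayed from [G1 :\: A1] alone: if the answers agree up
    to round [t], then so do the query and the set of fresh pairs asked so far.
    The fresh pairs are known to be edges, and the other queried pairs are
    edges exactly when they lie in [G1 :\: A1]. *)
Lemma fresh_determined G1 G2 (A1 A2 : {set vpair n}) :
    fresh G1 \subset G1 -> fresh G2 \subset G2 ->
    A1 \subset fresh G1 -> A2 \subset fresh G2 ->
    G1 :\: A1 = G2 :\: A2 ->
  forall t, t <= l -> answers A G1 t = answers A G2 t.
Proof.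
move=> F1 F2 sA1 sA2 eqD; elim=> // t IH tl.
have eqA := IH (ltnW tl).
have half (H1 H2 B1 B2 : {set vpair n}) : B1 \subset fresh H1 ->
    fresh H2 \subset H2 -> H1 :\: B1 = H2 :\: B2 ->
    answers A H1 t = answers A H2 t ->
    asked H1 t :&: H1 \subset asked H2 t :&: H2.
  move=> sB1 FH2 eqD' eqA'; apply/subsetP => e; rewrite !inE (asked_ext eqA').
  case/andP=> eQ eH1; rewrite eQ /=.
  case: (boolP (e \in B1)) => [eB|eB].
    rewrite -(asked_ext eqA') in eQ.
    have [s st fs] := first_asked_exists eQ.
    by apply: (subsetP FH2); apply: fresh_ext eqA' _ st fs _; rewrite ?(subsetP sB1).
  by have : e \in H1 :\: B1 by [rewrite inE eB]; rewrite eqD' inE => /andP[].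
rewrite /= -/(asked G1 t) -/(asked G2 t); congr rcons => //.
by apply/eqP; rewrite eqEsubset (half _ _ A1 A2) // (half _ _ A2 A1).
Qed.

(** Each such graph [G] yields at least [2 ^ b] pairs [(G, C)] with
    [C \subset fresh G], and [(G, C) |-> G :\: C] is injective by
    [fresh_determined]. *)
Lemma card_fresh_le b :
  #|[set G | (fresh G \subset G) && (b <= #|fresh G|)]| * 2 ^ b <= 2 ^ #|{: vpair n}|.
Proof.
set B := [set G | _].
pose X := [set p : sgraph n * {set vpair n} | (p.1 \in B) && (p.2 \subset fresh p.1)].
have BX : #|B| * 2 ^ b <= #|X|.
  rewrite -sum_nat_const.
  have -> : #|X| = \sum_(G in B) \sum_(C : {set vpair n} | C \subset fresh G) 1.
    by rewrite pair_big_dep -sum1_card; apply: eq_bigl => p; rewrite inE.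
  apply: leq_sum => G; rewrite inE => /andP[_ bF].
  have -> : \sum_(C : {set vpair n} | C \subset fresh G) 1 = #|powerset (fresh G)|.
    by rewrite -sum1_card; apply: eq_bigl => C; rewrite inE.
  by rewrite card_powerset leq_exp2l.
apply: leq_trans BX _.
have inj : {in X &, injective (fun p : sgraph n * {set vpair n} => p.1 :\: p.2)}.
  move=> [G1 A1] [G2 A2]; rewrite !inE /=.
  move=> /andP[/andP[F1 _] sA1] /andP[/andP[F2 _] sA2] eqD.
  have eqA := fresh_determined F1 F2 sA1 sA2 eqD.
  have eqF : fresh G1 = fresh G2.
    apply/setP => e; rewrite !inE; apply: eq_existsb => t.
    have eqt := eqA t (ltnW (ltn_ord t)).
    by rewrite (first_asked_ext _ eqt) (reg_ext eqt).
  have recover (H C : {set vpair n}) : C \subset fresh H -> fresh H \subset H ->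
      H = (H :\: C) :|: fresh H.
    move=> CF FH; apply/eqP; rewrite eqEsubset; apply/andP; split.
      apply/subsetP => e eH; rewrite !inE eH andbT.
      by case: (boolP (e \in C)) => //= /(subsetP CF); rewrite inE.
    by rewrite subUset subDset subsetUr FH.
  have eG : G1 = G2.
    by rewrite (recover _ _ sA1 F1) (recover _ _ sA2 F2) eqD eqF.
  congr pair => //; move: eqD; rewrite eG => /setP eqD.
  apply/setP => e; move/(_ e): eqD; rewrite !inE.
  have : e \in A1 -> e \in G2 by move/(subsetP sA1)/(subsetP F1); rewrite eG.
  have : e \in A2 -> e \in G2 by move/(subsetP sA2)/(subsetP F2).
  by case: (e \in A1); case: (e \in A2) => // h1 h2; [rewrite h2 | rewrite h1].
rewrite -(card_in_imset inj) -card_sgraph.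
by apply: subset_leq_card; apply/subsetP.
Qed.
End Fresh.

Definition all_asked G (S : {set 'I_n}) :=
  [forall e : vpair n, (val e \subset S) ==> [exists t : 'I_l, e \in asked G t]].

(** Deleting from [G] an edge of the output that was not asked changes neither
    the answers nor the output, but the output is no longer a clique. The edge
    is chosen as a function of the answers, so this map is injective. *)
Lemma card_unasked_clique :
  #|[set G | clique G (output A G l) && ~~ all_asked G (output A G l)]| * 2
    <= 2 ^ #|{: vpair n}|.
Proof.
set B := [set G | _].
pose pk G := [pick e : vpair n | (val e \subset output A G l) &&
   [forall t : 'I_l, e \notin asked G t]].
pose phi G : sgraph n := if pk G is Some e then G :\ e else G.
have phiP G : G \in B -> exists e, [/\ pk G = Some e, val e \subset output A G l,
    e \in G & answers A (G :\ e) l = answers A G l].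
  rewrite inE => /andP[cl /forallPn[e]]; rewrite negb_imply => /andP[sub nex].
  rewrite /pk; case: pickP => [f /andP[fs /forallP nf]|/(_ e)]; last first.
    rewrite sub /= => /negbT/forallPn[t]; rewrite negbK => et.
    by case/negP: nex; apply/existsP; exists t.
  exists f; split=> //; first by move/forallP: cl => /(_ f) /implyP; apply.
  have : forall t, t <= l -> answers A (G :\ f) t = answers A G t; last by apply.
  elim=> // t IH tl; have eqA := IH (ltnW tl); rewrite /= eqA; congr rcons.
  apply/setP => g; rewrite !inE; case: (eqVneq g f) => //= ->.
  by rewrite -/(asked G t) (negPf (nf (Ordinal tl))).
have out G H : answers A G l = answers A H l -> output A G l = output A H l.
  by rewrite /output => ->.
have pk_ext G H : answers A G l = answers A H l -> pk G = pk H.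
  move=> eqA; apply: eq_pick => e; rewrite (out _ _ eqA); congr andb.
  apply: eq_forallb => t; rewrite (asked_ext (answers_prefix eqA _)) //.
  exact: ltnW.
have inj : {in B &, injective phi}.
  move=> G1 G2 /phiP[e1 [p1 s1 h1 a1]] /phiP[e2 [p2 s2 h2 a2]].
  rewrite /phi p1 p2 => eqG.
  have eqA : answers A G1 l = answers A G2 l by rewrite -a1 eqG a2.
  have [e12] : Some e1 = Some e2 by rewrite -p1 -p2; exact: pk_ext.
  by rewrite -(setD1K h1) -(setD1K h2) eqG e12.
have dis : [disjoint B & phi @: B].
  apply/pred0P => G /=; apply/negP => /andP[GB /imsetP[H HB eG]].
  have [e [pe se eH aH]] := phiP _ HB.
  move: GB; rewrite inE => /andP[/forallP/(_ e)/implyP cl _]; move: cl.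
  rewrite eG /phi pe (out _ _ aH) => /(_ se).
  by rewrite !inE eqxx.
rewrite muln2 -addnn -{2}(card_in_imset inj) -card_sgraph.
have -> : #|B| + #|phi @: B| = #|B :|: phi @: B|.
  by rewrite cardsU (disjoint_setI0 dis) cards0 subn0.
exact: max_card.
Qed.

End Queries.

(** * Encoding the cliques that are found *)

Section Encoding.
Variables (n : nat) (A : strategy n) (l K m u : nat).
Hypothesis hl : 2 < l.
Hypothesis askedK : forall G t, t < l -> #|asked A G t| <= K.

Definition code := ({ffun 'I_m -> 'I_l * 'I_K} * {ffun 'I_u -> 'I_n})%type.

Lemma card_code : #|{: code}| = (l * K) ^ m * n ^ u.
Proof. by rewrite card_prod !card_ffun card_prod !card_ord. Qed.

(** The default value [set0] is returned for ranks beyond the size of the query,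
    which do not occur in the codes of interest. *)
Definition decode (c : code) (G : sgraph n) (j : 'I_m) : {set 'I_n} :=
  nth set0 [seq val e | e <- enum (asked A G (c.1 j).1)] (c.1 j).2.

Definition region (c : code) (G : sgraph n) (t : nat) : {set 'I_n} :=
  [set c.2 i | i : 'I_u] :|: \bigcup_(j | (c.1 j).1 <= t) decode c G j.

Lemma region_ext c G1 G2 t : answers A G1 t = answers A G2 t ->
  region c G1 t = region c G2 t.
Proof.
move=> eqA; rewrite /region; congr setU; apply: eq_bigr => j jt.
by rewrite /decode (asked_ext (answers_prefix eqA jt)).
Qed.

Definition asking_round (G : sgraph n) (f : {set 'I_n}) : nat :=
  find (fun t => [exists e : vpair n, (val e == f) && (e \in asked A G t)]) (iota 0 l).

Lemma asking_roundP G (e : vpair n) (t : 'I_l) : e \in asked A G t ->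
  asking_round G (val e) < l /\ first_asked A G (asking_round G (val e)) e.
Proof.
move=> et; pose a s := e \in asked A G s.
have -> : asking_round G (val e) = find a (iota 0 l).
  apply: eq_find => s; apply/existsP/idP => [[f /andP[/eqP/val_inj->]]//|es].
  by exists e; rewrite eqxx.
have ha : has a (iota 0 l) by apply/hasP; exists (t : nat) => //; rewrite mem_iota /= add0n.
have lt : find a (iota 0 l) < l by move: ha; rewrite has_find size_iota.
split=> //; rewrite /first_asked; have := nth_find 0 ha.
rewrite nth_iota // add0n => ea; rewrite [e \in _]ea; apply/forallP => s.
have := before_find 0 (ltn_ord s); rewrite nth_iota ?add0n /a => [->//|].
exact: ltn_trans (ltn_ord s) lt.
Qed.

(** The code lists, for a matching given by [few_stale_pairs], the round and the
    rank of each of its edges, and then the [u] unmatched vertices of the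
    output. A pair of the output is fresh for this code if it is not stale for
    the matching. *)
Lemma exists_code b G : let S := output A G l in
    clique G S -> all_asked A l G S -> #|S| = m.*2 + u ->
    (forall T, (\sum_(j < l) path_bound l j) * T + m ^ 2
        <= (\sum_(j < l) path_bound l j) * m ^ 2 -> b + T <= 'C(m.*2 + u, 2)) ->
  exists c, (fresh A l (region c) G \subset G) && (b <= #|fresh A l (region c) G|).
Proof.
move=> S cl aS cS hb; pose rho := asking_round G.
have rhoP (e : vpair n) : val e \subset S -> rho (val e) < l /\ first_asked A G (rho (val e)) e.
  move=> eS; have /forallP/(_ e)/implyP/(_ eS)/existsP[t] := aS.
  exact: asking_roundP.
have pairP x y : x \in S -> y \in S -> x != y ->
    exists2 e : vpair n, val e = [set x; y] & val e \subset S.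
  move=> xS yS xy; have c2 : #|[set x; y]| == 2 by rewrite cards2 xy.
  exists (Sub [set x; y] c2); rewrite SubK //.
  by apply/subsetP => z; rewrite !inE => /pred2P[]->.
have rho_lt x y : x \in S -> y \in S -> x != y -> rho [set x; y] < l.
  by move=> xS yS xy; have [e <- /rhoP[]] := pairP _ _ xS yS xy.
have mS : m.*2 <= #|S| by rewrite cS leq_addr.
have [M [sM uM MS fewM]] := few_stale_pairs hl rho_lt mS.
have /eqP szM := sM; pose p := tnth (Tuple szM).
have pM j : p j \in M by exact: mem_tnth.
have [f hf] : exists f : 'I_m -> 'I_l * 'I_K, forall j,
    (f j).1 = rho (edge (p j)) :> nat /\
    nth set0 [seq val e | e <- enum (asked A G (f j).1)] (f j).2 = edge (p j).
  apply: (@fin_all_exists _ _ (fun j (ri : 'I_l * 'I_K) =>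
    ri.1 = rho (edge (p j)) :> nat /\
    nth set0 [seq val e | e <- enum (asked A G ri.1)] ri.2 = edge (p j))) => j.
  have p1S : (p j).1 \in S.
    by apply: MS; apply/vertsP; exists (p j); rewrite ?mem_edge ?eqxx.
  have p2S : (p j).2 \in S.
    by apply: MS; apply/vertsP; exists (p j); rewrite ?mem_edge ?eqxx ?orbT.
  have [e ee eS] := pairP _ _ p1S p2S (edge_neq uM (pM j)).
  have [rl] := rhoP e eS; rewrite ee -/(edge (p j)) => /andP[er _].
  have ei : e \in enum (asked A G (rho (edge (p j)))) by rewrite mem_enum.
  have iK : index e (enum (asked A G (rho (edge (p j))))) < K.
    have rl' : rho (edge (p j)) < l by rewrite /edge -ee.
    apply: leq_trans (askedK G rl').
    by rewrite cardE index_mem.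
  rewrite ee in rl.
  exists (Ordinal rl, Ordinal iK); split=> //=.
  by rewrite (nth_map e) ?index_mem // nth_index.
pose U := S :\: [set z in verts M].
have cU : u = #|U|.
  rewrite cardsD (setIidPr _); last by apply/subsetP => z; rewrite inE => /MS.
  by rewrite cardsE (card_uniqP uM) size_verts sM cS addKn.
pose c : code := ([ffun j => f j], [ffun i => enum_val (cast_ord cU i)]).
have decE j : decode c G j = edge (p j).
  by have [_ h] := hf j; rewrite /decode /c /= ffunE.
have rndE j : (c.1 j).1 = rho (edge (p j)) :> nat.
  by have [h _] := hf j; rewrite /c /= ffunE.
have regS t : region c G t \subset S.
  apply/subUsetP; split.
    apply/subsetP => z /imsetP[i _ ->]; rewrite /c /= ffunE.
    by have := enum_valP (cast_ord cU i); rewrite inE => /andP[].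
  apply/bigcupsP => j _; rewrite decE; apply/subsetP => z zp.
  by apply: MS; apply/vertsP; exists (p j).
have URt z t : z \in S -> z \notin verts M -> z \in region c G t.
  move=> zS zM; have zU : z \in U by rewrite !inE zS zM.
  rewrite inE; apply/orP; left; apply/imsetP.
  exists (cast_ord (esym cU) (enum_rank_in zU z)) => //.
  by rewrite /c /= ffunE cast_ordKV enum_rankK_in.
exists c; apply/andP; split.
  apply/subsetP => e; rewrite inE => /existsP[t /andP[_ sub]].
  by have /forallP/(_ e)/implyP := cl; apply; apply: subset_trans sub (regS t).
rewrite -(leq_add2r #|stale_pairs S rho M|).
apply: leq_trans (_ : 'C(m.*2 + u, 2) <= _); last first.
  rewrite -cS -cards_draws -(card_imset (mem (fresh A l (region c) G)) val_inj).
  apply: leq_trans (leq_card_setU _ _).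
  apply: subset_leq_card; apply/subsetP => g; rewrite inE => /andP[gS g2].
  apply/setUP; case: (boolP (g \in stale_pairs S rho M)) => [|nst]; [by right | left].
  move: nst; rewrite inE g2 gS /= => nst.
  apply/imsetP; exists (Sub g g2); rewrite ?SubK //.
  have := rhoP (Sub g g2); rewrite SubK => /(_ gS)[rl fa].
  rewrite inE; apply/existsP; exists (Ordinal rl); rewrite /= fa /=.
  apply/subsetP => z zg; case: (boolP (z \in verts M)) => [|/URt->//]; last exact: (subsetP gS).
  case/vertsP=> r rM zr.
  have /tnthP[j rj] : r \in Tuple szM by [].
  rewrite inE; apply/orP; right; apply/bigcupP; exists j; last by rewrite decE /p -rj.
  rewrite rndE /p -rj leqNgt; apply: contra nst => lt.
  apply/existsP; exists (edge r); rewrite inE map_f //= lt andbT.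
  by apply/pred0Pn; exists z; rewrite /= zg.
by move: (hb _ fewM).
Qed.

Lemma card_bigcup_le (I T : finType) (B : I -> {set T}) :
  #|\bigcup_i B i| <= \sum_i #|B i|.
Proof.
elim/big_ind2: _ => [|s1 X s2 Y h1 h2|//]; first by rewrite cards0.
exact: leq_trans (leq_card_setU _ _) (leq_add h1 h2).
Qed.

Lemma card_asked_clique b :
    (forall T, (\sum_(j < l) path_bound l j) * T + m ^ 2
        <= (\sum_(j < l) path_bound l j) * m ^ 2 -> b + T <= 'C(m.*2 + u, 2)) ->
  #|[set G | [&& clique G (output A G l), #|output A G l| == m.*2 + u
     & all_asked A l G (output A G l)]]| * 2 ^ b
    <= (l * K) ^ m * n ^ u * 2 ^ #|{: vpair n}|.
Proof.
move=> hb; set X := [set G | _].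
pose B (c : code) := [set G | (fresh A l (region c) G \subset G)
  && (b <= #|fresh A l (region c) G|)].
have XB : X \subset \bigcup_c B c.
  apply/subsetP => G; rewrite inE => /and3P[cl /eqP cS aS].
  have [c hc] := exists_code cl aS cS hb.
  by apply/bigcupP; exists c; rewrite // inE.
apply: (@leq_trans (\sum_(c : code) #|B c| * 2 ^ b)).
  rewrite -big_distrl /= leq_mul2r; apply/orP; right.
  exact: leq_trans (subset_leq_card XB) (card_bigcup_le B).
rewrite -card_code -sum_nat_const.
by apply: leq_sum => c _; apply: card_fresh_le => G1 G2 t; exact: region_ext.
Qed.

End Encoding.

Section NatCount.
Local Open Scope nat_scope.

(** At most half of all graphs have a clique as output in which some pair was not
    asked, and at most a quarter have one that is counted by codes. *)
Lemma card_success_le n (A : strategy n) l K m u b :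
    2 < l -> (forall G t, t < l -> #|asked A G t| <= K) ->
    (forall T, (\sum_(j < l) path_bound l j) * T + m ^ 2
        <= (\sum_(j < l) path_bound l j) * m ^ 2 -> b + T <= 'C(m.*2 + u, 2)) ->
    4 * ((l * K) ^ m * n ^ u) <= 2 ^ b ->
  4 * #|[set G | clique G (output A G l) && (#|output A G l| == m.*2 + u)]|
    <= 3 * 2 ^ #|{: vpair n}|.
Proof.
move=> hl hK hb hsmall.
have h1 := card_unasked_clique A l; have h2 := card_asked_clique hl hK hb.
set X1 := [set G | _] in h1; set X2 := [set G | _] in h2; set X := [set G | _].
have hX : #|X| <= #|X1| + #|X2|.
  apply: leq_trans (leq_card_setU _ _); apply: subset_leq_card.
  apply/subsetP => G; rewrite !inE => /andP[-> ->] /=.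
  by case: (all_asked _ _ _ _).
have b0 : 0 < 2 ^ b by rewrite expn_gt0.
move: h1 h2 hX hsmall; move: (#|X1|) (#|X2|) (#|X|) (2 ^ #|_|) => x1 x2 x e.
move: ((l * K) ^ m * n ^ u) => c h1 h2 hX hsmall.
have h3 : x2 * 4 <= e.
  rewrite -(leq_pmul2r b0); apply: (@leq_trans (4 * c * e)).
    by rewrite mulnAC mulnC -mulnA leq_mul2l.
  by rewrite mulnC leq_mul2l hsmall orbT.
lia.
Qed.

End NatCount.

(** * Asymptotics *)

From mathcomp Require Import all_classical all_reals all_analysis.
Import Order.TTheory GRing.Theory Num.Theory.
Import numFieldNormedType.Exports.

Local Open Scope ring_scope.

Lemma er_prob_half (R : realType) n (E : pred (sgraph n)) :
  er_prob (2^-1 : R) E = #|[set G | E G]|%:R / 2 ^+ #|{: vpair n}|.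
Proof.
have mass (G : sgraph n) : er_mass (2^-1 : R) G = 2^-1 ^+ #|{: vpair n}|.
  rewrite /er_mass -prodr_const; apply: eq_bigr => e _.
  by case: ifP => // _; lra.
rewrite /er_prob; under eq_bigr do rewrite mass.
rewrite sumr_const -[LHS]mulr_natl exprVn; congr (_%:R * _).
by apply: eq_card => G; rewrite inE.
Qed.

(** To leading order, with [k = a * j] and [m = mu * j], the difference of the
    two sides is [(a - a ^+ 2 / 2 - D * mu + c * mu ^+ 2) * j ^+ 2]; rounding
    [k] and [m] changes it by a term linear in [j]. *)
Lemma exponent_eventually_neg (R : realType) (a mu c D lam : R) :
    0 <= a -> 0 <= mu -> 0 <= c -> 0 <= D -> 0 <= lam ->
    a - a ^+ 2 / 2 < D * mu - c * mu ^+ 2 ->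
  exists J : nat, forall j : nat, (J <= j)%N -> forall k m : R,
    0 <= k -> 0 <= m -> k <= a * j%:R < k + 1 -> m <= mu * j%:R < m + 1 ->
  2 + lam * m + j%:R * k - D * j%:R * m + c * m ^+ 2 <= k * (k - 1) / 2.
Proof.
move=> a0 mu0 c0 D0 lam0 neg; pose eps := D * mu - c * mu ^+ 2 - (a - a ^+ 2 / 2).
have eps0 : 0 < eps by rewrite /eps; lra.
pose C := D + a * 2 + lam * mu + 2.
exists (Num.truncn (C / eps)).+1 => j Jj k m k0 m0 /andP[ka ak] /andP[mmu mum].
have C0 : 0 <= C by rewrite /C; have := mulr_ge0 lam0 mu0; lra.
have j1 : 1 <= j%:R :> R by rewrite ler1n; apply: leq_ltn_trans Jj.
have jC : C <= eps * j%:R.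
  rewrite mulrC -ler_pdivrMr //; apply: ltW.
  have := truncn_itv (divr_ge0 C0 (ltW eps0)) => /andP[_ h].
  by apply: lt_le_trans h _; rewrite ler_nat.
move: (j%:R) j1 jC ka ak mmu mum => x x1 xC ka ak mmu mum.
have e1 : x * k <= a * x ^+ 2 by nra.
have e2 : - (D * x * m) <= - (D * mu * x ^+ 2) + D * x.
  have : D * x * (mu * x - 1) <= D * x * m.
    by apply: ler_wpM2l; [apply: mulr_ge0 => //; lra | lra].
  by nra.
have e3 : c * m ^+ 2 <= c * mu ^+ 2 * x ^+ 2.
  rewrite -mulrA -exprMn; apply: ler_wpM2l => //.
  by rewrite ler_sqr ?nnegrE //; apply: le_trans mmu.
have e4 : lam * m <= lam * mu * x by rewrite -mulrA; apply: ler_wpM2l.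
have e5 : a ^+ 2 * x ^+ 2 - 2 * a * x <= k ^+ 2.
  case: (leP (a * x) 1) => [le1|gt1]; last by nra.
  have ax0 : 0 <= a * x by apply: mulr_ge0 => //; lra.
  by nra.
have e6 : C * x <= eps * x ^+ 2.
  by rewrite expr2 mulrA; apply: ler_wpM2r => //; lra.
rewrite /C /eps in e6.
have -> : k * (k - 1) / 2 = k ^+ 2 / 2 - k / 2 by field.
lra.
Qed.

Lemma natr_bin2 (R : realType) k : 'C(k, 2)%:R = k%:R * (k%:R - 1) / 2 :> R.
Proof.
elim: k => [|k IH]; first by rewrite bin0n !mul0r.
by rewrite binS bin1 natrD IH -natr1; field.
Qed.

Lemma asked_le_num_queries n (A : strategy n) G l t :
  (t < l)%N -> (#|asked A G t| <= num_queries A G l)%N.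
Proof. by move=> tl; rewrite /num_queries (bigD1 (Ordinal tl)) //= leq_addr. Qed.

Lemma code_count_small (R : realType) (delta : R) (l K m u b j : nat) :
    K%:R <= (2 ^ j)%:R `^ delta ->
    2 + l%:R * m%:R + delta * j%:R * m%:R + j%:R * u%:R <= b%:R ->
  (4 * ((l * K) ^ m * (2 ^ j) ^ u) <= 2 ^ b)%N.
Proof.
move=> hK hexp; rewrite -(ler_nat R) !natrM !natrX.
have two (x : nat) : 2 ^+ x = 2 `^ x%:R :> R by rewrite powR_mulrn.
have add (x y : R) : 2 `^ (x + y) = 2 `^ x * 2 `^ y.
  by rewrite powRD // pnatr_eq0 implybT.
have hlK : (l * K)%:R <= 2 `^ (l%:R + delta * j%:R) :> R.
  rewrite add natrM; apply: ler_pM => //.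
    by rewrite -two -natrX ler_nat ltnW // ltn_expl.
  by apply: le_trans hK _; rewrite natrX two -powRrM mulrC.
have hm : (l * K)%:R ^+ m <= 2 `^ ((l%:R + delta * j%:R) * m%:R) :> R.
  by rewrite powRrM powR_mulrn ?powR_ge0 // lerXn2r ?nnegrE ?powR_ge0.
rewrite (two b); apply: (@le_trans _ _ (2 `^ (2 + l%:R * m%:R + delta * j%:R * m%:R + j%:R * u%:R))); last first.
  by apply: ler_powR => //; lra.
rewrite -[_ + delta * _ * _]addrA -mulrDl !add.
rewrite -mulrA; apply: ler_pM; rewrite ?mulr_ge0 ?exprn_ge0 //.
  by rewrite powRr1 //; lra.
rewrite -natrM; apply: ler_pM; rewrite ?exprn_ge0 //.
by rewrite -exprM two natrM.
Qed.

(** It suffices to consider numbers of vertices of the form [2 ^ j], for which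
    the base 2 logarithm is an integer. The hypothesis [2 * mu <= a] makes room
    for a matching of [mu * j] edges in the output. *)
Lemma not_achievable (R : realType) (delta a mu : R) (l : nat) :
    let Q := (\sum_(j < l) path_bound l j)%N in
    let c := 1 - Q%:R^-1 : R in
    (2 < l)%N -> 0 <= delta <= 2 -> 0 <= mu -> 2 * mu <= a ->
    a - a ^+ 2 / 2 < (2 - delta) * mu - c * mu ^+ 2 ->
  ~ achievable delta l a.
Proof.
move=> Q c hl /andP[d0 d2] mu0 mua neg [A [hq hlim]].
have Q0 : (0 < Q)%N.
  by rewrite /Q (bigD1 (Ordinal (ltnW (ltnW hl)))) //= addn_gt0 path_bound_gt0 // ltnW // ltnW.
have QR0 : 0 < Q%:R :> R by rewrite ltr0n.
have c0 : 0 <= c by rewrite /c subr_ge0 invf_le1 // ler1n.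
have D0 : 0 <= 2 - delta by lra.
have a0 : 0 <= a by lra.
have [J hJ] := exponent_eventually_neg a0 mu0 c0 D0 (ler0n R l) neg.
have lt34 : 3 / 4 < 1 :> R by lra.
have [N0 _ hN0] := cvgr_gt _ hlim _ lt34.
pose j := maxn J N0; pose n := (2 ^ j)%N.
have N0n : (N0 <= n)%N.
  by apply: leq_trans (leq_maxr J N0) _; rewrite ltnW // ltn_expl.
have := hN0 n N0n; rewrite /= er_prob_half.
have aj0 : 0 <= a * j%:R by rewrite mulr_ge0.
have muj0 : 0 <= mu * j%:R by rewrite mulr_ge0.
pose k := Num.truncn (a * j%:R); pose m := Num.truncn (mu * j%:R).
have hk : k%:R <= a * j%:R < k%:R + 1 by rewrite natr1 truncn_itv.
have hm : m%:R <= mu * j%:R < m%:R + 1 by rewrite natr1 truncn_itv.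
have mk : (m.*2 <= k)%N.
  rewrite truncn_ge_nat // -muln2 natrM mulrC.
  apply: (@le_trans _ _ (2 * (mu * j%:R))); first by case/andP: hm; lra.
  by rewrite mulrA ler_wpM2r.
have logn : log2 (n%:R : R) = j%:R.
  rewrite /log2 (natrX R 2 j) lnXn // -[_ *+ j]mulr_natl mulfK // gt_eqF //.
  by rewrite ln_gt0 // ltr1n.
pose u := (k - m.*2)%N.
have ku : (m.*2 + u)%N = k by rewrite subnKC.
pose K := Num.truncn ((n%:R : R) `^ delta).
have hK G t : (t < l)%N -> (#|asked (A n) G t| <= K)%N.
  move=> tl; rewrite truncn_ge_nat ?powR_ge0 //.
  apply: le_trans (hq n G); last by rewrite ler_nat asked_le_num_queries.
have hexp := hJ j (leq_maxl _ _) k%:R m%:R (ler0n _ _) (ler0n _ _) hk hm.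
rewrite -natr_bin2 in hexp.
(* the largest number of stale pairs that few_stale_pairs allows *)
pose s := ((Q.-1 * m ^ 2) %/ Q)%N.
have hs : s%:R <= c * m%:R ^+ 2.
  have : (s * Q <= Q.-1 * m ^ 2)%N by exact: leq_trunc_div.
  rewrite -(ler_nat R) !natrM -subn1 natrB // -ler_pdivlMr // => hs.
  have -> // : c * m%:R ^+ 2 = (Q%:R - 1) * (m%:R * m%:R) / Q%:R.
  by rewrite /c; field; rewrite gt_eqF.
have uE : u%:R = k%:R - 2 * m%:R :> R.
  by rewrite natrB // -muln2 natrM mulrC.
have {}hexp : 2 + l%:R * m%:R + delta * j%:R * m%:R + j%:R * u%:R + s%:R
    <= 'C(k, 2)%:R :> R.
  apply: le_trans hexp.
  have -> : 2 + l%:R * m%:R + j%:R * k%:R - (2 - delta) * j%:R * m%:R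
      + c * m%:R ^+ 2
    = 2 + l%:R * m%:R + delta * j%:R * m%:R + j%:R * u%:R + c * m%:R ^+ 2.
    by rewrite uE; ring.
  by rewrite lerD2l.
have sC : (s <= 'C(k, 2))%N.
  by rewrite -(ler_nat R); apply: le_trans hexp; rewrite lerDr !addr_ge0 ?mulr_ge0.
pose b := ('C(k, 2) - s)%N.
have hb T : (Q * T + m ^ 2 <= Q * m ^ 2)%N -> (b + T <= 'C(m.*2 + u, 2))%N.
  rewrite ku => hT; have : (T <= s)%N.
    rewrite /s leq_divRL //; move: hT; rewrite mulnC -(prednK Q0) mulSn /=.
    by rewrite addnC leq_add2l.
  by move=> Ts; rewrite -[leqRHS](subnK sC) leq_add2l.
have hsmall : (4 * ((l * K) ^ m * n ^ u) <= 2 ^ b)%N.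
  apply: (code_count_small (R := R) (delta := delta)).
    by rewrite truncn_le powR_ge0.
  by rewrite /b (natrB _ sC) lerBrDr.
have := card_success_le hl hK hb hsmall.
rewrite ku ltr_pdivlMr ?exprn_gt0 // => h2 h1.
have : 4 * #|[set G | finds_clique l a (A n) G]|%:R <= 3 * 2 ^+ #|{: vpair n}| :> R.
  move: h2; rewrite -(ler_nat R) !natrM natrX; apply: le_trans.
  rewrite ler_wpM2l // ler_nat subset_leq_card //.
  by apply/fintype.subsetP => G; rewrite !inE /finds_clique logn.
move: h1; move: (2 ^+ _) #|_|%:R => e x lt34x le34x.
lra.
Qed.

Theorem corollary2 (R : realType) (delta : R) (l : nat)
    (hdelta : 1 <= delta <= 2) (hl : (3 <= l)%N) :
  (alpha_star delta l <=
    (1 + Num.sqrt (1 - (2 - delta) ^+ 2 /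
       (2 - 1 / (3 * 2 ^+ (l - 3)%N - l%:R + 2))))%:E)%E.
Proof.
case/andP: hdelta => d1 d2.
set N : R := 3 * 2 ^+ (l - 3)%N - l%:R + 2.
pose Q := (\sum_(j < l) path_bound l j)%N.
have QN : Q%:R = 2 * N.
  have [k lk] : exists k, l = k.+3 by exists (l - 3)%N; rewrite -addn3 subnK.
  have := sum_path_bound hl; rewrite -/Q /N lk -addn3 addnK.
  rewrite (_ : (k + 3 - 2 = k.+1)%N); last by lia.
  move=> /(congr1 (fun x => x%:R : R)).
  rewrite -muln2 expnS !natrD !natrM natrX natrD => h.
  lra.
have N2 : 2 <= N.
  rewrite /N; have := ltn_expl (l - 3) (isT : (1 < 2)%N).
  rewrite -(ler_nat R) -natr1 natrX natrB // => h.
  have : 1 <= 2 ^+ (l - 3) :> R by apply: exprn_ege1; lra.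
  lra.
have N0 : N != 0 by rewrite gt_eqF //; lra.
apply: ge_ereal_sup => _ [a ach <-]; rewrite lee_fin leNgt.
apply/negP => lta; pose D := 2 - delta; pose c : R := 1 - Q%:R^-1.
have cN : 2 - 1 / N = 2 * c by rewrite /c QN; field.
have c34 : 3 / 4 <= c.
  have : Q%:R^-1 <= 4^-1 :> R by rewrite lef_pV2 ?posrE // QN; lra.
  by rewrite /c; lra.
have c0 : 0 < c by lra.
rewrite cN -/D in lta.
pose x := D ^+ 2 / (2 * c).
have D01 : 0 <= D <= 1 by rewrite /D; lra.
have x0 : 0 <= x by rewrite /x divr_ge0 ?sqr_ge0 //; lra.
have x23 : x <= 2 / 3.
  rewrite /x ler_pdivrMr; last by lra.
  by case/andP: D01 => D0 D1; nra.
have s0 : 0 <= Num.sqrt (1 - x) by exact: sqrtr_ge0.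
have s2 : Num.sqrt (1 - x) ^+ 2 = 1 - x by apply: sqr_sqrtr; lra.
rewrite -/x in lta; move: (Num.sqrt _) s0 s2 lta => s s0 s2 lta.
(* y <= sqrt y on [0, 1], so that a > 4 / 3; this leaves room for the matching *)
have s13 : 1 / 3 <= s by nra.
apply: (@not_achievable R delta a (D / (2 * c)) l) ach => //; first lra.
- by apply: divr_ge0; lra.
- apply: (@le_trans _ _ (4 / 3)); last by lra.
  have -> : 2 * (D / (2 * c)) = D / c by field; rewrite gt_eqF.
  rewrite ler_pdivrMr //; lra.
rewrite -/Q -/c -/D.
have -> : D * (D / (2 * c)) - c * (D / (2 * c)) ^+ 2 = x / 2.
  by rewrite /x; field; rewrite gt_eqF.
nra.
Qed.
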